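(* Let $F$ be a field and let $m(x)=x^3+ax^2+bx+c\in F[x]$ be irreducible. Assume that $m$ is separable. Let $A,B,C\in\mathcal{C}(m)$. If $B-A$ is invertible, $C-A$ is invertible, and $(B-A)B(B-A)^{-1}\neq(C-A)C(C-A)^{-1}$, then $\mathcal{V}(A,B,C)$ is invertible.
   Context: $M_3(F)$ is the ring of $3\times 3$ matrices over $F$. $\mathcal{C}(m)$ is the set of all $A\in M_3(F)$ whose minimal polynomial is $m$. $\mathcal{V}(A,B,C)$ denotes the $9\times 9$ block Vandermonde matrix $\begin{bmatrix} I&I&I\\ A&B&C\\ A^2&B^2&C^2\end{bmatrix}$, where $I$ is the $3\times 3$ identity matrix. *)

(* Defs.v *)
From mathcomp Require Import all_boot all_algebra all_field.

Set Implicit Arguments.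
Unset Strict Implicit.
Unset Printing Implicit Defensive.

Import GRing.Theory.

Local Open Scope ring_scope.

(* [mxminpoly A] is monic, so this set is empty unless m is monic. *)
Definition minpoly_class (F : fieldType) (m : {poly F}) : {pred 'M[F]_3} :=
  [pred A | mxminpoly A == m].

(* The dimension 3 + (3 + 3) is convertible to 9. *)
Definition block_vandermonde (F : fieldType) (A B C : 'M[F]_3) :
    'M[F]_(3 + (3 + 3)) :=
  col_mx (row_mx 1%:M (row_mx 1%:M 1%:M))
 (col_mx (row_mx A (row_mx B C))
         (row_mx (A *m A) (row_mx (B *m B) (C *m C)))).

(* Main.v *)
Require Import Defs.
From mathcomp Require Import all_boot all_algebra all_field.

Import GRing.Theory.

Local Open Scope ring_scope.

(* Dividing [m] on the right by [x - A] over the matrix ring gives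
   [x^2 + (A + a) x + (A^2 + a A + b)]. If [m(B) = 0] and [D = B - A] is
   invertible, [X = D B D^-1] is a root of this quotient, and so is
   [Y = (C - A) C (C - A)^-1]. Subtracting the two equations shows that
   [E = X - Y] satisfies [E Y = P E] with [P = - (X + A + a)], so the row space
   of [E] is stable under [Y]. As [Y] is conjugate to [C], whose minimal
   polynomial is irreducible of full degree, [E] is zero or invertible. Block
   elimination in the Vandermonde matrix, based on
   [B^2 - A^2 = D B + A D], leaves [E] as the last pivot up to unit factors. *)

(** The algebra [F[C]] is a field: irreducibility and the degree bound make [p] coprime to the
    minimal polynomial, and a Bezout relation evaluated at [C] gives the inverse. *)
Lemma unit_horner_mx (F : fieldType) n (C : 'M[F]_n.+1) (p : {poly F}) :
  irreducible_poly (mxminpoly C) -> p != 0 ->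
  (size p < size (mxminpoly C))%N -> horner_mx C p \is a GRing.unit.
Proof.
move=> irr p0 sp.
have cop : coprimep (mxminpoly C) p.
  rewrite irreducible_poly_coprime //.
  by apply: contraTN sp => /(dvdp_leq p0); rewrite leqNgt.
have /Bezout_coprimepP[[u v] /= /eqpP[[k l] /= /andP[k0 l0]]] := cop.
move=> /(congr1 (horner_mx C)).
rewrite -!mul_polyC mulr1 !rmorphM rmorphD !rmorphM /= mx_root_minpoly.
rewrite mulr0 add0r !horner_mx_C => e.
have uvp : horner_mx C (k%:P * v) * horner_mx C p = l%:M.
  by rewrite rmorphM /= horner_mx_C -mulrA.
have : horner_mx C p *m horner_mx C (k%:P * v) = l%:M.
  by rewrite -uvp -[LHS]/(_ * _) -!rmorphM mulrC.
move=> /(congr1 (fun M => l^-1 *: M)) /=; rewrite scalemxAr scale_scalar_mx.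
by rewrite mulVf // => /mulmx1_unit[].
Qed.

(** The row space of [G] is stable under [C], and any nonzero vector [v] in it is cyclic for [C], so
    it is the whole space. *)
Lemma unit_intertwiner (F : fieldType) n (C P G : 'M[F]_n.+1) :
  irreducible_poly (mxminpoly C) -> size (mxminpoly C) = n.+2 ->
  G *m C = P *m G -> G != 0 -> G \in unitmx.
Proof.
move=> irr sz GC /rowV0Pn[v vG v0].
have vGX k : (v *m C ^+ k <= G)%MS.
  elim: k => [|k IH]; first by rewrite expr0 mulmx1.
  rewrite exprSr mulmxA; apply: submx_trans (submxMr C IH) _.
  by rewrite GC submxMl.
pose W := \matrix_(i < n.+1) (v *m C ^+ i).
have WG : (W <= G)%MS by apply/row_subP => i; rewrite rowK.
rewrite -row_full_unit -sub1mx; apply: submx_trans WG.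
rewrite sub1mx row_full_unit -row_free_unit.
apply: inj_row_free => u uW.
(* A relation among the rows [v C^i] reads [v p(C) = 0] with [p] of degree at most [n]. If [p] were
   nonzero, [p(C)] would be invertible and [v] would vanish. *)
have {}uW : v *m horner_mx C (rVpoly u) = 0.
  rewrite -[RHS]uW [RHS]mulmx_sum_row [rVpoly u]poly_def rmorph_sum /= mulmx_sumr.
  apply: eq_bigr => i _.
  rewrite rowK linearZ /= rmorphXn /= horner_mx_X -scalemxAr.
  by rewrite valK.
apply/eqP; rewrite -[u]rVpolyK; apply/negPn/negP => u0.
have ru0 : rVpoly u != 0 by apply: contraNneq u0 => ->; rewrite linear0.
have ru : (size (rVpoly u) < size (mxminpoly C))%N.
  by rewrite sz ltnS; apply: size_poly.
have up := unit_horner_mx _ _ _ _ irr ru0 ru.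
move/eqP: v0; apply.
by rewrite -[v]mulmx1 -[1%:M](mulmxV up) mulmxA uW mul0mx.
Qed.

Lemma conjugate_root_quotient (F : fieldType) (R : unitAlgType F)
    (a b c : F) (A B : R) :
  A ^+ 3 + a *: A ^+ 2 + b *: A + c%:A = 0 ->
  B ^+ 3 + a *: B ^+ 2 + b *: B + c%:A = 0 ->
  B - A \is a GRing.unit ->
  let X := (B - A) * B / (B - A) in
  X ^+ 2 + (A + a%:A) * X + (A ^+ 2 + a *: A + b%:A) = 0.
Proof.
move=> hA hB uD; set D := B - A => X.
have XD : X * D = D * B by rewrite /X mulrVK.
apply: (mulIr uD); rewrite -/D mul0r !mulrDl expr2 -![_ * X * D]mulrA XD.
rewrite [X * _]mulrA XD -!scalerAl !mul1r.
(* After right multiplication by [D], where [X D = D B], noncommutative telescoping turns the left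
   side into [m(B) - m(A)]. *)
have D2 : D * B + A * D = B ^+ 2 - A ^+ 2.
  by rewrite /D mulrBl mulrBr addrA subrK.
have D3 : D * B * B + A * (D * B) + A ^+ 2 * D = B ^+ 3 - A ^+ 3.
  rewrite [A ^+ 2]expr2 -[A * A * D]mulrA -addrA -mulrDr D2 -mulrA -expr2.
  by rewrite /D mulrBl mulrBr -!exprS addrA subrK.
rewrite addrA [D * B * B + _]addrA [X in X + _]addrACA D3 -scalerDr D2 /D !scalerBr.
rewrite -[RHS](subrr 0) -{1}hB -hA opprD [RHS]addrACA subrr addr0.
by rewrite opprD [RHS]addrACA opprD [X in _ = X + _]addrACA.
Qed.

Lemma root_difference_intertwiner (R : pzRingType) (Q K X Y : R) :
  X ^+ 2 + Q * X + K = 0 -> Y ^+ 2 + Q * Y + K = 0 ->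
  (X - Y) * Y = - (X + Q) * (X - Y).
Proof.
move=> hX hY; have e := addIr _ (etrans hX (esym hY)).
rewrite mulNr -mulrN opprB mulrBr [_ * X]mulrDl -expr2 e mulrBl mulrDl -expr2.
by rewrite opprD addrACA subrr addr0.
Qed.

Theorem corollary5p12 (F : fieldType) (a b c : F) (m : {poly F})
    (m_def : m = 'X^3 + a *: 'X^2 + b *: 'X + c%:P)
    (m_irr : irreducible_poly m) (m_sep : separable_poly m)
    (A B C : 'M[F]_3)
    (mA : A \in minpoly_class m) (mB : B \in minpoly_class m)
    (mC : C \in minpoly_class m)
    (uBA : (B - A) \in unitmx) (uCA : (C - A) \in unitmx)
    (neqBC : (B - A) *m B *m invmx (B - A) <> (C - A) *m C *m invmx (C - A)) :
  block_vandermonde A B C \in unitmx.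
Proof.
have root M : M \in minpoly_class m ->
    M ^+ 3 + a *: M ^+ 2 + b *: M + c%:A = 0.
  move=> /eqP eM; have := mx_root_minpoly M; rewrite eM m_def.
  rewrite !rmorphD /= !linearZ /= !rmorphXn /= horner_mx_X horner_mx_C.
  by rewrite -scalemx1.
have hX := conjugate_root_quotient _ _ _ _ _ _ _ (root _ mA) (root _ mB) uBA.
have hY := conjugate_root_quotient _ _ _ _ _ _ _ (root _ mA) (root _ mC) uCA.
move: neqBC hX hY; rewrite -!/(_ * _) -!/(_^-1).
set X := _ * _ / _; set Y := (C - A) * C / _ => /= neqXY hX hY.
have XD : X * (B - A) = (B - A) * B by rewrite /X mulrVK.
have YD : Y * (C - A) = (C - A) * C by rewrite /Y mulrVK.
have EY := root_difference_intertwiner _ _ _ _ _ hX hY.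
have uE : X - Y \is a GRing.unit.
  have sz : size m = 4%N.
    rewrite m_def -!addrA size_polyDl size_polyXn //.
    do ?[rewrite (leq_ltn_trans (size_polyD _ _)) // gtn_max; apply/andP; split];
      rewrite ?(leq_ltn_trans (size_scale_leq _ _)) ?size_polyXn ?size_polyX //.
    exact: leq_ltn_trans (size_polyC_leq1 _) _.
  (* The factor [C - A] turns [Y] into [C], so the hypothesis on the minimal polynomial of [C]
     applies without transporting it to [Y]. *)
  have := unit_intertwiner _ _ C (- (X + (A + a%:A))) ((X - Y) * (C - A)).
  rewrite (eqP mC) => /(_ m_irr sz) h.
  rewrite -(unitrMl _ uCA); apply: h.
    by rewrite -[LHS]mulrA -YD [LHS]mulrA EY -mulrA.
  rewrite -[0](mul0r (C - A)) (inj_eq (mulIr uCA)) subr_eq0.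
  exact/eqP.
rewrite -row_free_unit; apply: inj_row_free => u.
rewrite -[u]hsubmxK -[rsubmx u]hsubmxK.
set x := lsubmx u; set y := lsubmx _; set z := rsubmx _.
rewrite /block_vandermonde !mul_row_col !mul_mx_row !add_row_mx !mulmx1.
move/eqP; rewrite !row_mx_eq0 => /and3P[/eqP eA /eqP eB /eqP eC].
(* For [(x, y, z)] in the left kernel, subtract the block equation at [A] from the one at [M] and
   cancel [M - A] on the right. *)
have eq1 M Z : M - A \in unitmx -> Z * (M - A) = (M - A) * M ->
    x + (y *m M + z *m (M *m M)) = 0 -> y + z *m A + z *m Z = 0.
  move=> uM ZM eM; apply: (can_inj (mulmxK uM)).
  rewrite mul0mx -addrA -mulmxDr mulmxDl -mulmxA mulmxDl -[Z *m _]/(Z * _) ZM.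
  have -> : A *m (M - A) + (M - A) * M = M *m M - A *m A.
    by rewrite addrC [(M - A) * M]mulmxBl mulmxBr addrA subrK.
  have := subrr (0 : 'rV[F]_3).
  by rewrite -{1}eM -eA opprD addrACA subrr add0r opprD addrACA -!mulmxBr.
have eX := eq1 _ _ uBA XD eB.
have eY := eq1 _ _ uCA YD eC.
(* The difference of [eX] and [eY] is [z (X - Y) = 0]. *)
have z0 : z = 0.
  apply: (can_inj (mulmxK uE)); rewrite mul0mx mulmxBr.
  by rewrite (addrI _ (etrans eX (esym eY))) subrr.
have y0 : y = 0 by move: eX; rewrite z0 !mul0mx !addr0.
have x0 : x = 0 by move: eA; rewrite y0 z0 !mul0mx !addr0.
by rewrite x0 y0 z0 !row_mx0.
Qed.
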